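(* There exist classes of structures $\mathfrak{C},\mathfrak{D}$ and a positive $\star$-enumerable functor $F:\mathfrak{C}\to\mathfrak{D}$ such that $F$ is not enumeration isomorphic to any positive enumerable functor $G:\mathfrak{C}\to\mathfrak{D}$.
   Context: Structures: all structures are countable with universe $\omega$, in a relational language $(R_i)_{i\in\omega}$ where $R_i$ has arity $a_i$ and $i\mapsto a_i$ is computable. A class of structures (in a fixed language) is viewed as a category whose morphisms are the isomorphisms between its members; $Hom(\mathcal{A},\mathcal{B})$ is the set of isomorphisms from $\mathcal{A}$ to $\mathcal{B}$. The languages of $\mathfrak{C}$ and $\mathfrak{D}$ may differ. A functor maps structures to structures and isomorphisms $f:\mathcal{A}\to\mathcal{B}$ to isomorphisms $F(f):F(\mathcal{A})\to F(\mathcal{B})$, preserving composition and identities. Coding: tuples of natural numbers are coded by numbers via a fixed computable coding $\langle\cdot\rangle$, and $\oplus$ and $\bigoplus_{i\in\omega}$ denote the usual effective joins of sets. $Graph(f)=\{\langle x,y\rangle: f(x)=y\}$. The positive diagram of $\mathcal{A}$ is $P(\mathcal{A})={=}\oplus{\neq}\oplus\bigoplus_{i\in\omega}R_i^{\mathcal{A}}$, where $=$ and $\neq$ are equality and inequality on $\omega$. An enumeration operator $\Psi$ is a c.e. set of pairs $(E,x)$ with $E$ (a code of) a finite set, and $\Psi^X=\{x:\exists E\subseteq X\ (E,x)\in\Psi\}$. A Turing operator $\Phi$ satisfies $\Phi^X=Y$ if it computes the characteristic function of $Y$ from the oracle $X$. A functor $F:\mathfrak{C}\to\mathfrak{D}$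 is positive enumerable if there are enumeration operators $\Psi,\Psi_*$ such that for all $\mathcal{A},\mathcal{B}\in\mathfrak{C}$: (1) $\Psi^{P(\mathcal{A})}=P(F(\mathcal{A}))$; (2) for all $f\in Hom(\mathcal{A},\mathcal{B})$, $\Psi_*^{P(\mathcal{A})\oplus Graph(f)\oplus P(\mathcal{B})}=Graph(F(f))$. A functor $F:\mathfrak{C}\to\mathfrak{D}$ is positive $\star$-enumerable if there are an enumeration operator $\Psi$ and a Turing operator $\Phi_*$ such that for all $\mathcal{A},\mathcal{B}\in\mathfrak{C}$: (1) $\Psi^{P(\mathcal{A})}=P(F(\mathcal{A}))$; (2) for all $f\in Hom(\mathcal{A},\mathcal{B})$, $\Phi_*^{P(\mathcal{A})\oplus Graph(f)\oplus P(\mathcal{B})}=Graph(F(f))$. A functor $F:\mathfrak{C}\to\mathfrak{D}$ is enumeration isomorphic to a functor $G:\mathfrak{C}\to\mathfrak{D}$ if there is an enumeration operator $\Lambda$ such that for every $\mathcal{A}\in\mathfrak{C}$, $\Lambda^{P(\mathcal{A})}$ is (the graph of) an isomorphism $F(\mathcal{A})\to G(\mathcal{A})$, and for every morphism $h\in Hom(\mathcal{A},\mathcal{B})$ in $\mathfrak{C}$, $\Lambda^{P(\mathcal{B})}\circ F(h)=G(h)\circ\Lambda^{P(\mathcal{A})}$. *)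

(* Defs.v *)
From mathcomp Require Import all_boot.
From mathcomp Require Import all_classical.

Set Implicit Arguments.
Unset Strict Implicit.
Unset Printing Implicit Defensive.

Local Open Scope classical_set_scope.

(** ** Oracle computability

Kleene's mu-recursive functions with an extra basic function, the
characteristic function of the oracle.  A program acts on a finite list of
arguments; missing arguments read as 0 and extra ones are ignored. *)

Inductive prog : Type :=
| Zero
| Succ
| Proj of nat
| Query
| Comp of prog & seq prog
| Rec of prog & prog
| Mu of prog.

(* [eval X p s y]: with oracle [X], program [p] halts on [s] with value [y].
   Composition is strict, and [Mu p] only halts at [y] if [p] halts with a
   positive value at every argument below [y]. *)
Fixpoint eval (X : set nat) (p : prog) (s : seq nat) (y : nat) {struct p} :
    Prop :=
  match p with
  | Zero => y = 0
  | Succ => y = (nth 0 s 0).+1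
  | Proj i => y = nth 0 s i
  | Query => (X (nth 0 s 0) /\ y = 1) \/ (~ X (nth 0 s 0) /\ y = 0)
  | Comp f gs =>
      exists2 t : seq nat,
        (fix evals (gs : seq prog) (t : seq nat) : Prop :=
           match gs, t with
           | [::], [::] => True
           | g :: gs', z :: t' => eval X g s z /\ evals gs' t'
           | _, _ => False
           end) gs t
        & eval X f t y
  | Rec f g =>
      (fix rec (n : nat) (y : nat) : Prop :=
         match n with
         | 0 => eval X f (behead s) y
         | n'.+1 => exists2 z, rec n' z & eval X g [:: n', z & behead s] y
         end) (nth 0 s 0) y
  | Mu f =>
      eval X f (y :: s) 0 /\
      forall i, i < y -> exists z, eval X f (i :: s) z.+1
  end.

Definition computable (f : nat -> nat) : Prop :=
  exists p, forall n, eval set0 p [:: n] (f n).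

Definition ce (W : set nat) : Prop :=
  exists p, forall n, W n <-> exists y, eval set0 p [:: n] y.

Definition turing_computes (Phi : prog) (X Y : set nat) : Prop :=
  forall n, (Y n -> eval X Phi [:: n] 1) /\ (~ Y n -> eval X Phi [:: n] 0).

(** ** Coding and enumeration operators *)

(* [CodeSeq.code] is a computable bijection [seq nat -> nat]. *)
Definition tcode (s : seq nat) : nat := CodeSeq.code s.

Definition join (X Y : set nat) : set nat :=
  [set n.*2 | n in X] `|` [set n.*2.+1 | n in Y].

Definition bigjoin (X : nat -> set nat) : set nat :=
  [set k | exists i x, X i x /\ k = tcode [:: i; x]].

Definition graph (f : nat -> nat) : set nat :=
  [set k | exists x, k = tcode [:: x; f x]].

(* The number [e] codes the finite set of entries of [CodeSeq.decode e]. *)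
Definition finset_of (e : nat) : set nat :=
  [set z | z \in CodeSeq.decode e].

(* An enumeration operator is a set [Psi] of codes of pairs with [ce Psi]. *)
Definition enum_apply (Psi X : set nat) : set nat :=
  [set x | exists e, finset_of e `<=` X /\ Psi (tcode [:: e; x])].

(** ** Structures with universe [nat] *)

Record language := Language {
  arity : nat -> nat;
  arity_computable : computable arity }.

Definition structure (L : language) : Type :=
  forall i, set ((arity L i).-tuple nat).

Definition pos_diagram (L : language) (A : structure L) : set nat :=
  join [set k | exists x, k = tcode [:: x; x]]
    (join [set k | exists x y, x != y /\ k = tcode [:: x; y]]
       (bigjoin (fun i => [set tcode (val t) | t in A i]))).

Record iso (L : language) (A B : structure L) := Iso {
  iso_fun :> nat -> nat;
  iso_bij : bijective iso_fun;
  iso_rel : forall i (t : (arity L i).-tuple nat),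
    A i t <-> B i (map_tuple iso_fun t) }.

Section IsoCategory.
Variable L : language.

Lemma iso_id_rel (A : structure L) i (t : (arity L i).-tuple nat) :
  A i t <-> A i (map_tuple id t).
Proof.
suff -> : map_tuple id t = t by [].
by apply: val_inj; rewrite /= map_id.
Qed.

Definition iso_id (A : structure L) : iso A A :=
  Iso (Bijective (frefl id) (frefl id)) (@iso_id_rel A).

Lemma iso_comp_rel (A B C : structure L) (g : iso B C) (f : iso A B)
    i (t : (arity L i).-tuple nat) :
  A i t <-> C i (map_tuple (g \o f) t).
Proof.
rewrite (iso_rel f) (iso_rel g).
suff -> : map_tuple (g \o f) t = map_tuple g (map_tuple f t) by [].
by apply: val_inj; rewrite /= map_comp.
Qed.

Definition iso_comp (A B C : structure L) (g : iso B C) (f : iso A B) :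
    iso A C :=
  Iso (bij_comp (iso_bij g) (iso_bij f)) (iso_comp_rel g f).

End IsoCategory.

(** ** Functors between classes of structures *)

(* A class is a set of structures in one language, used as the full groupoid
   of isomorphisms between its members (it need not be isomorphism-closed). *)
Record functor (L L' : language) (C : set (structure L))
    (D : set (structure L')) := Functor {
  fobj :> C -> D;
  fmap : forall A B : C,
    iso (val A) (val B) -> iso (val (fobj A)) (val (fobj B));
  fmap_id : forall A : C, fmap (iso_id (val A)) =1 id;
  fmap_comp : forall (A B E : C) (g : iso (val B) (val E))
      (f : iso (val A) (val B)),
    fmap (iso_comp g f) =1 fmap g \o fmap f }.

Section Functors.
Variables (L L' : language) (C : set (structure L)) (D : set (structure L')).
Implicit Types F G : functor C D.

Definition hom_oracle (A B : structure L) (f : iso A B) : set nat :=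
  join (pos_diagram A) (join (graph f) (pos_diagram B)).

Definition enumerates_objects F (Psi : set nat) : Prop :=
  forall A : C,
    enum_apply Psi (pos_diagram (val A)) = pos_diagram (val (F A)).

Definition positive_enumerable F : Prop :=
  exists Psi Psis : set nat,
    [/\ ce Psi, ce Psis, enumerates_objects F Psi &
      forall (A B : C) (f : iso (val A) (val B)),
        enum_apply Psis (hom_oracle f) = graph (fmap F f)].

Definition positive_star_enumerable F : Prop :=
  exists (Psi : set nat) (Phis : prog),
    [/\ ce Psi, enumerates_objects F Psi &
      forall (A B : C) (f : iso (val A) (val B)),
        turing_computes Phis (hom_oracle f) (graph (fmap F f))].

Definition enumeration_isomorphic F G : Prop :=
  exists Lambda : set nat, ce Lambda /\
  exists eta : forall A : C, iso (val (F A)) (val (G A)),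
    (forall A : C,
       enum_apply Lambda (pos_diagram (val A)) = graph (eta A)) /\
    (forall (A B : C) (h : iso (val A) (val B)),
       eta B \o fmap F h =1 fmap G h \o eta A).

End Functors.

(* Main.v *)
Require Import Defs.
From mathcomp Require Import all_boot.
From mathcomp Require Import all_classical.

(** Enumeration operators are monotone, Turing operators are not.  Take the
language in which every relation is nullary.  Any bijection of [nat] between
structures with the same true relations is then an isomorphism.  Let [F] be
the identity on objects, and let it send [f : A -> B] to [f] if the relation
[R_0] holds in [A], and to the identity map otherwise.  This is a functor
because isomorphic structures agree on [R_0].

The functor is positive star-enumerable: the identity enumeration operator
handles objects, and an oracle machine can ask whether [R_0] holds and then
look up either the graph of [f] or the relation [=] in its oracle
([gate_progP]).

It is not enumeration isomorphic to a positive enumerable [G].  Let [A] be the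
structure without true relations and [A'] the one where exactly [R_0] holds,
and let [h] be the transposition of 0 and 1, an automorphism of both.
Everything positive about [A] is also positive about [A'], so by monotonicity
([enum_apply_graph_mono]) the components [eta_A] and [eta_A'] of the
isomorphism are the same map, and [G] sends the two copies of [h] to the same
map.  Naturality then makes the two maps [F h] equal, although one is the
identity and the other is [h]. *)

Set Implicit Arguments.
Unset Strict Implicit.
Unset Printing Implicit Defensive.

Local Open Scope classical_set_scope.

(** * Programs for total functions *)

(** The equivalence packages termination together with uniqueness of the
result; uniqueness is what lets one read a value back from a halting run. *)
Definition computes (X : set nat) (p : prog) (F : seq nat -> nat) : Prop :=
  forall s y, eval X p s y <-> y = F s.

Section Programs.
Variable X : set nat.

Lemma computes_zero : computes X Zero (fun=> 0).
Proof. by []. Qed.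

Lemma computes_proj i : computes X (Proj i) (fun s => nth 0 s i).
Proof. by []. Qed.

Lemma computes_comp1 f g F G : computes X f F -> computes X g G ->
  computes X (Comp f [:: g]) (fun s => F [:: G s]).
Proof.
move=> fF gG s y /=; split=> [[[|z [|? ?]] //= []]|->].
- by move=> /gG -> _ /fF.
- by move=> _ [].
- by exists [:: G s]; [split=> //; apply/gG | apply/fF].
Qed.

Lemma computes_comp2 f g h F G H :
  computes X f F -> computes X g G -> computes X h H ->
  computes X (Comp f [:: g; h]) (fun s => F [:: G s; H s]).
Proof.
move=> fF gG hH s y /=; split=> [[[|z [|w [|? ?]]] //= []]|->].
- by move=> _ [].
- by move=> /gG -> [/hH -> _] /fF.
- by move=> _ [_ []].
- by exists [:: G s; H s]; [split; [apply/gG | split=> //; apply/hH]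
                           | apply/fF].
Qed.

Lemma computes_succ g G :
  computes X g G -> computes X (Comp Succ [:: g]) (fun s => (G s).+1).
Proof. exact: (@computes_comp1 Succ g (fun s => (nth 0 s 0).+1)). Qed.

Lemma computes_rec f g F G (H : nat -> seq nat -> nat) :
  computes X f F -> computes X g G ->
  (forall s, H 0 s = F s) ->
  (forall n s, H n.+1 s = G [:: n, H n s & s]) ->
  computes X (Rec f g) (fun s => H (nth 0 s 0) (behead s)).
Proof.
move=> fF gG H0 HS s y /=.
elim: (nth 0 s 0) y => [|n IHn] y; first by rewrite H0; exact: fF.
split=> [[z /IHn -> /gG ->]|->]; first by rewrite HS.
by exists (H n (behead s)); [apply/IHn | apply/gG; rewrite HS].
Qed.

Definition add_prog := Rec (Proj 0) (Comp Succ [:: Proj 1]).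

Lemma computes_add f g F G : computes X f F -> computes X g G ->
  computes X (Comp add_prog [:: f; g]) (fun s => F s + G s).
Proof.
have addP : computes X add_prog (fun s => nth 0 s 0 + nth 0 (behead s) 0).
  apply: (@computes_rec _ _ (fun s => nth 0 s 0) (fun s => (nth 0 s 1).+1)
    (fun n s => n + nth 0 s 0)) => //.
  exact: computes_succ (computes_proj 1).
by move=> fF gG; apply: (computes_comp2 addP fF gG).
Qed.

Definition mul_prog := Rec Zero (Comp add_prog [:: Proj 2; Proj 1]).

Lemma computes_mul f g F G : computes X f F -> computes X g G ->
  computes X (Comp mul_prog [:: f; g]) (fun s => F s * G s).
Proof.
have mulP : computes X mul_prog (fun s => nth 0 s 0 * nth 0 (behead s) 0).
  apply: (@computes_rec _ _ (fun=> 0) (fun s => nth 0 s 2 + nth 0 s 1)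
    (fun n s => n * nth 0 s 0)) => //.
  by apply: computes_add; exact: computes_proj.
by move=> fF gG; apply: (computes_comp2 mulP fF gG).
Qed.

Definition exp2_prog :=
  Rec (Comp Succ [:: Zero]) (Comp add_prog [:: Proj 1; Proj 1]).

Lemma computes_exp2 f F : computes X f F ->
  computes X (Comp exp2_prog [:: f]) (fun s => 2 ^ F s).
Proof.
have expP : computes X exp2_prog (fun s => 2 ^ nth 0 s 0).
  apply: (@computes_rec _ _ (fun=> 1) (fun s => nth 0 s 1 + nth 0 s 1)
    (fun n s => 2 ^ n)) => //.
  - exact: computes_succ computes_zero.
  - by apply: computes_add; exact: computes_proj.
  - by move=> n s; rewrite expnS mul2n -addnn.
by move=> fF; apply: (computes_comp1 expP fF).
Qed.

Definition pred_prog := Rec Zero (Proj 0).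

(* The recursion runs on the first argument, which is hence the number that
   is subtracted. *)
Definition sub_prog := Rec (Proj 0) (Comp pred_prog [:: Proj 1]).

Lemma computes_sub f g F G : computes X f F -> computes X g G ->
  computes X (Comp sub_prog [:: g; f]) (fun s => F s - G s).
Proof.
have predP : computes X pred_prog (fun s => (nth 0 s 0).-1).
  exact: (@computes_rec _ _ (fun=> 0) (fun s => nth 0 s 0) (fun n _ => n.-1)).
have subP : computes X sub_prog (fun s => nth 0 (behead s) 0 - nth 0 s 0).
  apply: (@computes_rec _ _ (fun s => nth 0 s 0) (fun s => (nth 0 s 1).-1)
    (fun n s => nth 0 s 0 - n)) => //.
  - exact: (computes_comp1 predP (computes_proj 1)).
  - by move=> s; rewrite subn0.
  - by move=> n s; rewrite subnS.
by move=> fF gG; apply: (computes_comp2 subP gG fF).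
Qed.

End Programs.

(** On input [n], search for the least [x] at which the distance between [n]
and [g x] vanishes. *)
Lemma ce_range (p : prog) (g : nat -> nat) :
  computes set0 p (fun s => g (nth 0 s 0)) -> ce (range g).
Proof.
move=> pg.
have distP := computes_add (computes_sub (@computes_proj set0 1) pg)
                           (computes_sub pg (@computes_proj set0 1)).
eexists (Mu _) => n; split=> [[x _ gx]|[y /= [/distP /= dy _]]].
- have ex : exists x, g x == n by exists x; rewrite gx.
  case: (ex_minnP ex) => y /eqP gy ymin; exists y; split.
    by apply/distP; rewrite /= gy subnn.
  move=> i ltiy; exists (n - g i + (g i - n)).-1; apply/distP.
  rewrite prednK //= addn_gt0 !subn_gt0 -neq_ltn.
  by apply/eqP => gi; move: (ymin i); rewrite gi eqxx leqNgt ltiy => /(_ isT).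
- exists y => //; move/esym/eqP: dy.
  rewrite addn_eq0 !subn_eq0 => /andP[ngy gyn].
  by apply/eqP; rewrite eqn_leq gyn ngy.
Qed.

(** * Enumeration operators *)

Lemma tcode_inj : injective tcode.
Proof. exact: can_inj CodeSeq.codeK. Qed.

Lemma enum_apply_mono (Psi X Y : set nat) :
  X `<=` Y -> enum_apply Psi X `<=` enum_apply Psi Y.
Proof.
by move=> XY x [e [eX Pe]]; exists e; split=> //; exact: subset_trans XY.
Qed.

Lemma graph_sub (f g : nat -> nat) : graph f `<=` graph g -> f =1 g.
Proof.
move=> fg x.
by have [|y /tcode_inj[-> ->]] := fg (tcode [:: x; f x]); first exists x.
Qed.

(** A total function has no proper extension, so an enumeration operator that
enumerates graphs of functions cannot react to additional information. *)
Lemma enum_apply_graph_mono (Psi X Y : set nat) (f g : nat -> nat) :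
  X `<=` Y -> enum_apply Psi X = graph f -> enum_apply Psi Y = graph g ->
  f =1 g.
Proof.
move=> XY Xf Yg; apply: graph_sub.
rewrite -Xf -Yg; exact: enum_apply_mono.
Qed.

Definition id_operator : set nat :=
  range (fun x => tcode [:: tcode [:: x]; x]).

Lemma finset_of1 (x : nat) : finset_of (tcode [:: x]) = [set x].
Proof.
by rewrite /finset_of /tcode CodeSeq.codeK; apply/seteqP; split=> z /=;
  rewrite mem_seq1 => /eqP.
Qed.

Lemma enum_apply_id (X : set nat) : enum_apply id_operator X = X.
Proof.
apply/seteqP; split=> x.
- case=> e [eX [y _ /tcode_inj[ye <-]]]; apply: eX.
  by rewrite -ye finset_of1.
- move=> Xx; exists (tcode [:: x]); split; last by exists x.
  by rewrite finset_of1 => _ ->.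
Qed.

Lemma ce_id_operator : ce id_operator.
Proof.
have arith x : tcode [:: tcode [:: x]; x] = 2 ^ (2 ^ x) * (2 ^ x + 2 ^ x).+1.
  by rewrite /tcode /= muln1 addnn.
rewrite /id_operator (_ : (fun x => _) =
  fun x => 2 ^ (2 ^ x) * (2 ^ x + 2 ^ x).+1); last exact/funext.
have xP := computes_exp2 (@computes_proj set0 0).
exact: (ce_range (computes_mul (computes_exp2 xP)
                               (computes_succ (computes_add xP xP)))).
Qed.

(** * The functor *)

Lemma computable0 : computable (fun=> 0).
Proof. by exists Zero. Qed.

Definition nullary : language := Language computable0.

Definition flag (A : structure nullary) : Prop :=
  A 0 ([tuple] : (arity nullary 0).-tuple nat).

Lemma nullary_map_tuple (f : nat -> nat) i (t : (arity nullary i).-tuple nat) :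
  map_tuple f t = t.
Proof. by rewrite (tuple0 t); apply: val_inj. Qed.

Lemma iso_flag (A B : structure nullary) : iso A B -> flag A = flag B.
Proof.
move=> f; apply/propext.
by rewrite /flag (iso_rel f) nullary_map_tuple.
Qed.

Definition gate_fun (A B : structure nullary) (f : iso A B) : nat -> nat :=
  if `[< flag A >] then iso_fun f else id.

Lemma gate_bij (A B : structure nullary) (f : iso A B) : bijective (gate_fun f).
Proof.
rewrite /gate_fun; case: ifP => _; first exact: iso_bij.
exact: (Bijective (frefl id) (frefl id)).
Qed.

Lemma gate_rel (A B : structure nullary) (f : iso A B) i
    (t : (arity nullary i).-tuple nat) :
  A i t <-> B i (map_tuple (gate_fun f) t).
Proof. by rewrite (iso_rel f) !nullary_map_tuple. Qed.

Definition gate (A B : structure nullary) (f : iso A B) : iso A B :=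
  Iso (gate_bij f) (gate_rel f).

Lemma gate_id (A : [set: structure nullary]) : gate (iso_id (val A)) =1 id.
Proof. by move=> x; rewrite /= /gate_fun; case: ifP. Qed.

Lemma gate_comp (A B E : [set: structure nullary])
    (g : iso (val B) (val E)) (f : iso (val A) (val B)) :
  gate (iso_comp g f) =1 gate g \o gate f.
Proof. by move=> x; rewrite /= /gate_fun -(iso_flag f); case: ifP. Qed.

Definition gate_functor :
    functor [set: structure nullary] [set: structure nullary] :=
  Functor (fobj := id) gate_id gate_comp.

(** * Computing the functor with an oracle *)

Lemma join_even (X Y : set nat) n : join X Y n.*2 <-> X n.
Proof.
split=> [[[m Xm /double_inj <-] //|[m _ /(congr1 odd)]]|Xn].
  by rewrite /= !odd_double.
by left; exists n.
Qed.

Lemma join_odd (X Y : set nat) n : join X Y n.*2.+1 <-> Y n.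
Proof.
split=> [[[m _ /(congr1 odd)]|[m Ym [/double_inj <-]] //]|Yn].
  by rewrite /= !odd_double.
by right; exists n.
Qed.

(** The number 3 codes the pair of the index 0 and the empty tuple, whose code
is 0; the three joins lead from 3 to 7, 15 and 30. *)
Lemma hom_oracle_flag (A B : structure nullary) (f : iso A B) :
  hom_oracle f 30 <-> flag A.
Proof.
rewrite /hom_oracle (join_even _ _ 15) /pos_diagram (join_odd _ _ 7).
rewrite (join_odd _ _ 3) /bigjoin; split=> [[i [x [Ax]]]|A0].
- rewrite -[3]/(tcode [:: 0; 0]) => /tcode_inj[i0 _]; subst i.
  by case: Ax => t At _; rewrite /flag (_ : [tuple] = t) // (tuple0 t).
- by exists 0, 0; split=> //; exists [tuple].
Qed.

Lemma hom_oracle_diag (A B : structure nullary) (f : iso A B) n :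
  hom_oracle f n.*2.*2 <-> graph id n.
Proof. by rewrite /hom_oracle join_even /pos_diagram join_even. Qed.

Lemma hom_oracle_graph (A B : structure nullary) (f : iso A B) n :
  hom_oracle f n.*2.*2.+1 <-> graph f n.
Proof. by rewrite /hom_oracle join_odd join_even. Qed.

Definition double_prog (p : prog) := Comp add_prog [:: p; p].

Lemma computes_double X g G : computes X g G ->
  computes X (double_prog g) (fun s => (G s).*2).
Proof. by move=> gG s y; rewrite -addnn; exact: computes_add. Qed.

Definition const_prog (n : nat) : prog :=
  iter n (fun p => Comp Succ [:: p]) Zero.

Lemma computes_const X n : computes X (const_prog n) (fun=> n).
Proof. by elim: n => [|n /computes_succ]; first exact: computes_zero. Qed.

(** In the oracle of [f], the number [4n] stands for membership of [n] in the
diagonal, and [4n + 1] for membership of [n] in the graph of [f]; so the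
answer about [R_0], read as 0 or 1, is exactly the offset that is needed. *)
Definition gate_prog : prog :=
  Comp Query [:: Comp add_prog [:: Comp Query [:: const_prog 30];
                                   double_prog (double_prog (Proj 0))]].

Lemma computes_query X g G : computes X g G ->
  computes X (Comp Query [:: g]) (fun s => `[< X (G s) >] : nat).
Proof.
apply: (@computes_comp1 X Query g (fun s => `[< X (nth 0 s 0) >] : nat)).
move=> s y /=; case: asboolP => Xs; split.
- by case=> -[].
- by move=> ->; left.
- by case=> -[].
- by move=> ->; right.
Qed.

Lemma gate_progP (A B : structure nullary) (f : iso A B) :
  turing_computes gate_prog (hom_oracle f) (graph (gate f)).
Proof.
have gateP : computes (hom_oracle f) gate_prog (fun s =>
    `[< hom_oracle f (`[< hom_oracle f 30 >] + (nth 0 s 0).*2.*2) >] : nat).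
  apply/computes_query/computes_add.
    exact: (computes_query (computes_const _ 30)).
  exact: (computes_double (computes_double (@computes_proj _ 0))).
have gateE n : hom_oracle f (`[< hom_oracle f 30 >] + n.*2.*2)
    <-> graph (gate f) n.
  rewrite (asbool_equiv_eq (hom_oracle_flag f)) /= /gate_fun.
  case: asboolP => _; first exact: hom_oracle_graph.
  exact: hom_oracle_diag.
by move=> n; split=> Gn; apply/gateP => /=; case: asboolP => //; rewrite gateE.
Qed.

Lemma gate_functor_star : positive_star_enumerable gate_functor.
Proof.
exists id_operator, gate_prog; split.
- exact: ce_id_operator.
- by move=> A; exact: enum_apply_id.
- by move=> A B f; exact: gate_progP.
Qed.

(** * Monotonicity as an obstruction *)

Definition flag_off : structure nullary := fun _ => set0.

Definition flag_on : structure nullary := fun i _ => i = 0.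

Lemma pos_diagram_flag_off_on : pos_diagram flag_off `<=` pos_diagram flag_on.
Proof.
move=> _ [[n En <-]|[_ [[n Nn <-]|[n [i [x [[t At _] _]]] <-]] <-]].
- by apply/join_even.
- by apply/join_odd/join_even.
- by case: At.
Qed.

Definition swap01 (x : nat) : nat := if x < 2 then 1 - x else x.

Lemma swap01K : involutive swap01.
Proof. by case=> [|[|x]]. Qed.

Definition nullary_aut (A : structure nullary) (f : nat -> nat)
    (fb : bijective f) : iso A A.
Proof. by exists f => // i t; rewrite nullary_map_tuple. Defined.

Lemma gate_functor_not_isomorphic
    (G : functor [set: structure nullary] [set: structure nullary]) :
  positive_enumerable G -> ~ enumeration_isomorphic gate_functor G.
Proof.
move=> [_ [Psis [_ _ _ PsisG]]] [Lambda [_ [eta [etaL etaN]]]].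
pose A : [set: structure nullary] := exist _ flag_off (mem_set I).
pose A' : [set: structure nullary] := exist _ flag_on (mem_set I).
pose h : iso (val A) (val A) := nullary_aut flag_off (inv_bij swap01K).
pose h' : iso (val A') (val A') := nullary_aut flag_on (inv_bij swap01K).
have eta_eq : eta A =1 eta A'.
  exact: enum_apply_graph_mono pos_diagram_flag_off_on (etaL A) (etaL A').
have G_eq : Defs.fmap G h =1 Defs.fmap G h'.
  apply: enum_apply_graph_mono (PsisG _ _ h) (PsisG _ _ h').
  move=> _ [[n An <-]|[_ [[n hn <-]|[n An <-]] <-]].
  - by apply/join_even; exact: pos_diagram_flag_off_on.
  - by apply/join_odd/join_even.
  - by apply/join_odd/join_odd; exact: pos_diagram_flag_off_on.
have F_eq : Defs.fmap gate_functor h 0 = Defs.fmap gate_functor h' 0.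
  apply: (bij_inj (iso_bij (eta A'))); rewrite -eta_eq.
  have := etaN _ _ h 0; have := etaN _ _ h' 0; rewrite /= => -> ->.
  by rewrite eta_eq G_eq.
move: F_eq; rewrite /= /gate_fun; case: asboolP => //.
by case: asboolP => // /(_ erefl).
Qed.

Theorem theorem23 :
  exists (L L' : language) (C : set (structure L)) (D : set (structure L'))
    (F : functor C D),
    positive_star_enumerable F /\
    forall G : functor C D,
      positive_enumerable G -> ~ enumeration_isomorphic F G.
Proof.
exists nullary, nullary, setT, setT, gate_functor; split.
- exact: gate_functor_star.
- exact: gate_functor_not_isomorphic.
Qed.
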